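(* Let $0<\delta<1$, $0<\varepsilon_a<\frac38$ and $\frac{6\varepsilon_a}{3-2\varepsilon_a}<\varepsilon_r<1$. Let $n_1<n_2<\cdots<n_s$ be a sequence of sample sizes such that $$n_s\ge2\left(\frac1{\varepsilon_r}+\frac13\right)\left(\frac1{\varepsilon_a}-\frac1{\varepsilon_r}-\frac13\right)\ln\left(\frac{2s}{\delta}\right).$$ Define $\widehat\mu_\ell=\frac1{n_\ell}\sum_{i=1}^{n_\ell}Z_i$ for $\ell=1,\ldots,s$. For $\ell=1,\ldots,s-1$, let $D_\ell=0$ if $$\frac12-\frac23\varepsilon_a-\sqrt{\frac14+\frac{n_\ell\varepsilon_a^2}{2\ln\frac{\delta}{2s}}}<\widehat\mu_\ell<\frac{6(1-\varepsilon_r)(3-\varepsilon_r)\ln\frac{\delta}{2s}}{2(3-\varepsilon_r)^2\ln\frac{\delta}{2s}-9n_\ell\varepsilon_r^2}$$ or $$\frac12+\frac23\varepsilon_a-\sqrt{\frac14+\frac{n_\ell\varepsilon_a^2}{2\ln\frac{\delta}{2s}}}<\widehat\mu_\ell<\frac{6(1+\varepsilon_r)(3+\varepsilon_r)\ln\frac{\delta}{2s}}{2(3+\varepsilon_r)^2\ln\frac{\delta}{2s}-9n_\ell\varepsilon_r^2},$$ and $D_\ell=1$ otherwise; let $D_s=1$. Suppose the stopping rule is that sampling is continued until $D_\ell=1$ for some $\ell\in\{1,\ldots,s\}$. Define $\widehat\mu=\frac1{\mathbf n}\sum_{i=1}^{\mathbf n}Z_i$, where $\mathbf n$ is the sample size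 when the sampling is terminated. Then $\Pr\{|\widehat\mu-\mu|<\varepsilon_a\text{ or }|\widehat\mu-\mu|<\varepsilon_r\mu\}\ge1-\delta$.
   Context: $Z$ is a random variable with values in $[0,1]$ and expectation $\mu=\mathbb E[Z]$; $Z_1,Z_2,\ldots$ are i.i.d. random samples of $Z$. Sample sizes are positive integers. Sampling stops at the smallest index $\ell$ with $D_\ell=1$, and then $\mathbf n=n_\ell$. If the quantity under a square root is negative, the corresponding double inequality is regarded as not satisfied. *)

(* Defs.v *)
From HB Require Import structures.
From mathcomp Require Import all_boot all_order all_algebra.
From mathcomp Require Import all_classical all_reals all_analysis.

Set Implicit Arguments.
Unset Strict Implicit.
Unset Printing Implicit Defensive.

Import Order.TTheory GRing.Theory Num.Theory.
Import numFieldNormedType.Exports.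

Local Open Scope classical_set_scope.
Local Open Scope ring_scope.

Definition mutually_independent d (T : measurableType d) (R : realType)
    (P : probability T R) (X : nat -> {RV P >-> R}) : Prop :=
  forall (J : seq nat) (A : nat -> set R), uniq J ->
    (forall i, i \in J -> measurable (A i)) ->
    P (\bigcap_(i in [set` J]) (X i @^-1` A i)) =
    (\prod_(i <- J) P (X i @^-1` A i))%E.

(* Equality of laws is only required on measurable sets: a [distribution] is
   a function on all sets, with meaningless values on non-measurable ones. *)
Definition iid_samples d (T : measurableType d) (R : realType)
    (P : probability T R) (Z : {RV P >-> R}) (X : nat -> {RV P >-> R}) : Prop :=
  mutually_independent X /\
  forall i (A : set R), measurable A ->
    distribution P (X i) A = distribution P Z A.

(* Samples are indexed from 0, i.e. [X 0, X 1, ...] stand for Z_1, Z_2, ... *)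
Definition sample_mean (T : Type) (R : realType) (X : nat -> T -> R)
    (m : nat) (w : T) : R :=
  m%:R^-1 * \sum_(i < m) X i w.

Section decision.
Context {R : realType}.
Implicit Types (s m : nat) (delta eps_a eps_r x : R).

Definition log_level delta s : R := ln (delta / (2 * s%:R)).

Definition radicand delta eps_a s m : R :=
  1 / 4 + m%:R * eps_a ^+ 2 / (2 * log_level delta s).

(* [Num.sqrt] is 0 on negative numbers, hence the explicit sign condition:
   the double inequalities fail when the radicand is negative. *)
(* The bounds come from M(x, v) > L / m (smaller root on the left), with L = ln (delta / 2s) and
   M(x, v) = (x - v)^2 / (2 (2v/3 + x/3) (2v/3 + x/3 - 1)) Massart's exponent:
   here v = x + eps_a on the left and v = x / (1 - eps_r) on the right; in
   [in_gap_lower], v = x - eps_a and v = x / (1 + eps_r). *)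
Definition in_gap_upper delta eps_a eps_r s m x : bool :=
  let L := log_level delta s in
  let r := radicand delta eps_a s m in
  [&& 0 <= r,
      1 / 2 - 2 / 3 * eps_a - Num.sqrt r < x &
      x < 6 * (1 - eps_r) * (3 - eps_r) * L /
          (2 * (3 - eps_r) ^+ 2 * L - 9 * m%:R * eps_r ^+ 2)].

Definition in_gap_lower delta eps_a eps_r s m x : bool :=
  let L := log_level delta s in
  let r := radicand delta eps_a s m in
  [&& 0 <= r,
      1 / 2 + 2 / 3 * eps_a - Num.sqrt r < x &
      x < 6 * (1 + eps_r) * (3 + eps_r) * L /
          (2 * (3 + eps_r) ^+ 2 * L - 9 * m%:R * eps_r ^+ 2)].

(* Stages are numbered 1, ..., s; [m] is the sample size and [x] the sample
   mean at stage [l]. *)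
Definition decision delta eps_a eps_r s l m x : bool :=
  (l == s) ||
  ~~ (in_gap_upper delta eps_a eps_r s m x ||
      in_gap_lower delta eps_a eps_r s m x).

End decision.

(* The smallest index in 1, ..., s at which [D] holds ([s.+1] if none). *)
Definition stopping_index (s : nat) (D : nat -> bool) : nat :=
  (find D (iota 1 s)).+1.

Lemma stopping_indexP (s : nat) (D : nat -> bool) : (0 < s)%N -> D s ->
  [/\ (1 <= stopping_index s D <= s)%N, D (stopping_index s D) &
      forall l, (1 <= l < stopping_index s D)%N -> ~~ D l].
Proof.
move=> s0 Ds; have hD : has D (iota 1 s).
  by apply/hasP; exists s => //; rewrite mem_iota s0 add1n ltnSn.
have lt_s : (find D (iota 1 s) < s)%N by rewrite -[ltnRHS](size_iota 1) -has_find.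
split; first by [].
  by have := nth_find 0%N hD; rewrite nth_iota.
case=> // l; rewrite ltnS /stopping_index ltnS => /= lt_l.
by have := before_find 0%N lt_l; rewrite nth_iota ?(ltn_trans lt_l)// => ->.
Qed.

(* [n l] is the sample size of stage [l]. *)
Definition stopped_sample_size (T : Type) (R : realType)
    (delta eps_a eps_r : R) (s : nat) (n : nat -> nat) (X : nat -> T -> R)
    (w : T) : nat :=
  n (stopping_index s (fun l =>
       decision delta eps_a eps_r s l (n l) (sample_mean X (n l) w))).

Definition stopped_mean (T : Type) (R : realType)
    (delta eps_a eps_r : R) (s : nat) (n : nat -> nat) (X : nat -> T -> R)
    (w : T) : R :=
  sample_mean X (stopped_sample_size delta eps_a eps_r s n X w) w.

(* Main.v *)
Require Import Defs.
From HB Require Import structures.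
From mathcomp Require Import all_boot all_order all_algebra.
From mathcomp Require Import all_classical all_reals all_analysis.
From mathcomp Require Import measurable_realfun ring lra.

Import Order.TTheory GRing.Theory Num.Theory.
Import numFieldNormedType.Exports.

Local Open Scope classical_set_scope.
Local Open Scope ring_scope.

(* Massart's form of the Chernoff-Hoeffding bound shows that at a stage of
   sample size [m], outside an event of probability at most [delta / s], the
   sample mean [x] satisfies [m (x - mu)^2 < 2 lam V(x, mu)] with
   [lam = ln (2 s / delta)] and [V(x, v) = w (1 - w)], [w = (2 v + x) / 3].
   If [x] misses [mu] both absolutely and relatively, then [x - eps_a] and
   [x / (1 + eps_r)] (or [x + eps_a] and [x / (1 - eps_r)]) lie between [mu]
   and [x]. The ratio [(x - v)^2 / V(x, v)] decreases when [v] moves towards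
   [x], so the same inequality holds with [mu] replaced by these two values,
   which is exactly one of the two conditions for continuing to sample; at the
   last stage the size condition makes the two inequalities incompatible. A
   union bound over the [s] stages and the two tails concludes. *)

(** * The stopping rule *)

(* Massart's exponent at [(x, v)] is [- (x - v)^2 / (2 massart_var x v)]. *)
Definition massart_var {R : realType} (x v : R) : R :=
  (2 / 3 * v + x / 3) * (1 - (2 / 3 * v + x / 3)).

Section gap.
Set Implicit Arguments.
Unset Strict Implicit.
Context {R : realType}.
Implicit Types x v mu m lam e ea er w : R.

Lemma massart_varC x v : massart_var (1 - x) (1 - v) = massart_var x v.
Proof. by rewrite /massart_var; field. Qed.

Lemma massart_var_gt0 x v : 0 <= x -> x < v -> v <= 1 -> 0 < massart_var x v.
Proof. by move=> x0 xv v1; rewrite /massart_var; apply: mulr_gt0; lra. Qed.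

(** This is the monotonicity in [v] of [(x - v)^2 / massart_var x v], cross-multiplied: the
    difference of the two sides has the factor [mu - v]. *)
Lemma massart_le x v mu : 0 <= x -> x <= v -> v <= mu -> mu <= 1 ->
  (x - v) ^+ 2 * massart_var x mu <= (x - mu) ^+ 2 * massart_var x v.
Proof.
move=> x0 xv vmu mu1; rewrite -subr_ge0.
have -> : (x - mu) ^+ 2 * massart_var x v - (x - v) ^+ 2 * massart_var x mu =
    (mu - v) * (x * (1 - x) * ((v - x) + (mu - x)) +
      2 / 3 * (1 - 2 * x) * ((v - x) * (mu - x))).
  by rewrite /massart_var; field.
apply: mulr_ge0; first by lra.
set a := v - x; set b := mu - x.
have a0 : 0 <= a by rewrite /a; lra.
have b0 : 0 <= b by rewrite /b; lra.
have b1 : b <= 1 - x by rewrite /b; lra.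
have h1 : 0 <= x * a * (1 - x - b) by apply: mulr_ge0; [exact: mulr_ge0|lra].
have h2 : 0 <= x * b * (1 - x) by apply: mulr_ge0; [exact: mulr_ge0|lra].
have h3 : 0 <= a * b by exact: mulr_ge0.
have h4 : 0 <= a * b * (1 - x) by apply: mulr_ge0; lra.
(* The bracket is the sum of the quantities in [h1] and [h2] and of one third of those in [h3] and
   [h4]. *)
nra.
Qed.

(** The strict [x < v] keeps [massart_var x v] positive; it would vanish at [x = v = 0]. *)
Lemma massart_closer m lam x v mu : 0 <= m -> 0 <= x -> x < v -> v <= mu ->
  mu <= 1 -> m * (x - mu) ^+ 2 < 2 * lam * massart_var x mu ->
  m * (x - v) ^+ 2 < 2 * lam * massart_var x v.
Proof.
move=> m0 x0 xv vmu mu1 H.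
have Vmu : 0 < massart_var x mu by apply: massart_var_gt0 => //; lra.
have Vv : 0 < massart_var x v by apply: massart_var_gt0 => //; lra.
rewrite -(ltr_pM2r Vmu).
apply: (@le_lt_trans _ _ (m * ((x - mu) ^+ 2 * massart_var x v))).
  by rewrite -mulrA ler_wpM2l// massart_le// ltW.
by rewrite mulrA [ltRHS]mulrAC ltr_pM2r.
Qed.

Lemma massart_closerC m lam x v mu : 0 <= m -> x <= 1 -> v < x -> mu <= v ->
  0 <= mu -> m * (x - mu) ^+ 2 < 2 * lam * massart_var x mu ->
  m * (x - v) ^+ 2 < 2 * lam * massart_var x v.
Proof.
move=> m0 x1 vx muv mu0 H.
have E y : (x - y) ^+ 2 = ((1 - x) - (1 - y)) ^+ 2 by ring.
rewrite E -massart_varC; apply: (massart_closer m0 _ _ _ _ (mu := 1 - mu)); try lra.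
by rewrite -E massart_varC.
Qed.

(** As [w (1 - w) = 1/4 - (1/2 - w)^2], the hypothesis bounds [|1/2 - w|] by the square root; one
    side is kept. Here [w] will be [x + 2/3 ea] or [x - 2/3 ea]. *)
Lemma absolute_gap m lam ea w : 0 < lam ->
  m * ea ^+ 2 < 2 * lam * (w * (1 - w)) ->
  0 <= 1 / 4 + m * ea ^+ 2 / (2 * - lam) /\
  1 / 2 - Num.sqrt (1 / 4 + m * ea ^+ 2 / (2 * - lam)) < w.
Proof.
move=> lam0 H; set r := 1 / 4 + _.
have H' : (1 / 2 - w) ^+ 2 < r.
  have -> : r = 1 / 4 - m * ea ^+ 2 / (2 * lam) by rewrite /r; field; lra.
  have : m * ea ^+ 2 / (2 * lam) < w * (1 - w).
    by rewrite ltr_pdivrMr ?mulr_gt0// [ltRHS]mulrC.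
  set q := m * ea ^+ 2 / _; rewrite expr2 => ?; nra.
have r0 : 0 < r by apply: le_lt_trans H'; exact: sqr_ge0.
split; first exact: ltW.
have : `|1 / 2 - w| < Num.sqrt r by rewrite -sqrtr_sqr ltr_sqrt.
by move=> /(le_lt_trans (ler_norm _)); lra.
Qed.

(** Here [e] is [- er] below the mean and [er] above it. With [v = x / (1 + e)] both sides of
    Massart's inequality have a factor [x]; once it is cancelled, the inequality is linear in [x].
    At [x = 0] the positive bound is enough. *)
Lemma relative_gap m lam e x : 0 < lam -> 0 <= m -> -1 < e -> e != 0 -> 0 <= x ->
  (0 < x -> m * (x - x / (1 + e)) ^+ 2 < 2 * lam * massart_var x (x / (1 + e))) ->
  x < 6 * (1 + e) * (3 + e) * - lam /
      (2 * (3 + e) ^+ 2 * - lam - 9 * m * e ^+ 2).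
Proof.
move=> lam0 m0 e1 e0 x0 H.
have e2 : 0 < e ^+ 2 by rewrite exprn_even_gt0.
have h1 : 0 <= m * e ^+ 2 by apply: mulr_ge0 => //; exact: ltW.
have h2 : 0 < (3 + e) ^+ 2 * lam by apply: mulr_gt0 => //; apply: exprn_gt0; lra.
have h3 : 0 < (1 + e) * (3 + e) * lam by apply: mulr_gt0 => //; apply: mulr_gt0; lra.
have -> : 6 * (1 + e) * (3 + e) * - lam / (2 * (3 + e) ^+ 2 * - lam - 9 * m * e ^+ 2)
   = 6 * (1 + e) * (3 + e) * lam / (2 * (3 + e) ^+ 2 * lam + 9 * m * e ^+ 2).
  by field; apply/andP; split; apply/eqP; nra.
have h4 : 0 < 2 * (3 + e) ^+ 2 * lam + 9 * m * e ^+ 2 by nra.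
rewrite ltr_pdivlMr//.
move: x0; rewrite le_eqVlt => /predU1P[<-|x0]; first by nra.
have {H} := H x0.
have -> : m * (x - x / (1 + e)) ^+ 2 = m * (x ^+ 2 * e ^+ 2) / (1 + e) ^+ 2.
  by field; lra.
have -> : 2 * lam * massart_var x (x / (1 + e)) =
   (2 * lam * x * (3 + e) * (3 * (1 + e) - x * (3 + e)) / 9) / (1 + e) ^+ 2.
  by rewrite /massart_var; field; lra.
have h5 : 0 < ((1 + e) ^+ 2)^-1 by rewrite invr_gt0 exprn_gt0//; lra.
rewrite ltr_pM2r//.
move=> H; rewrite -(ltr_pM2l x0); nra.
Qed.

(* The bound on the last sample size is the one for which Massart's exponent
   equals [- lam / m] at [mu = ea / er], [x = mu + ea], the point where the
   absolute and the relative errors coincide; there [w = ea (1 / er + 1 / 3)],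
   and the lower bound on [er] says that this is at most [1 / 2]. *)
Lemma last_stage_size m lam ea er w : 0 < lam -> 0 < ea -> 0 < er ->
  ea * (1 / er + 1 / 3) <= 1 / 2 ->
  2 * (1 / er + 1 / 3) * (1 / ea - 1 / er - 1 / 3) * lam <= m ->
  w <= ea * (1 / er + 1 / 3) ->
  2 * lam * (w * (1 - w)) <= m * ea ^+ 2.
Proof.
move=> lam0 ea0 er0; set i := 1 / er => hw Hm.
have E : 2 * (i + 1 / 3) * (1 / ea - i - 1 / 3) * lam * ea ^+ 2 =
   2 * lam * ((ea * (i + 1 / 3)) * (1 - ea * (i + 1 / 3))).
  by field; lra.
move=> ww0; apply: le_trans (ler_wpM2r (sqr_ge0 ea) Hm); rewrite E.
rewrite ler_pM2l ?mulr_gt0//; nra.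
Qed.

(** After clearing denominators, the claim that the bound is at most [ea / er * (1 + e)] is the
    inequality of [last_stage_size] at [v = ea / er], [x = v (1 + e)]. *)
Lemma relative_gap_last m lam ea er e x : 0 < lam -> 0 < ea -> 0 < er < 1 ->
  `|e| = er ->
  ea * (1 / er + 1 / 3) <= 1 / 2 ->
  2 * (1 / er + 1 / 3) * (1 / ea - 1 / er - 1 / 3) * lam <= m ->
  x < 6 * (1 + e) * (3 + e) * - lam /
      (2 * (3 + e) ^+ 2 * - lam - 9 * m * e ^+ 2) ->
  x < ea / er * (1 + e).
Proof.
move=> lam0 ea0 /andP[er0 er1] eer hw Hm.
have e2 : e ^+ 2 = er ^+ 2 by rewrite -eer real_normK// num_real.
have /andP[e1 e3] : - er <= e <= er by rewrite -ler_norml eer.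
have u0 : 0 < ea / er by exact: divr_gt0.
have ww0 : ea / er * ((3 + e) / 3) <= ea * (1 / er + 1 / 3).
  have -> : ea * (1 / er + 1 / 3) = ea / er * ((3 + er) / 3) by field; lra.
  by rewrite ler_pM2l//; lra.
have := last_stage_size lam0 ea0 er0 hw Hm ww0.
have -> : m * ea ^+ 2 = m * er ^+ 2 * (ea / er) * (ea / er) by field; lra.
(* The product [u * k] is the centroid [w] for [v = u] and [x = u (1 + e)]; it is largest at
   [e = er]. *)
rewrite e2; set u := ea / er in u0 ww0 *; set k := (3 + e) / 3 in ww0 *.
have k0 : 0 < k by rewrite /k; lra.
have -> : 2 * lam * (u * k * (1 - u * k)) = 2 * lam * k * (1 - u * k) * u by ring.
rewrite ler_pM2r// => H /lt_le_trans; apply.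
have m0 : 0 < m * er ^+ 2 * u.
  by apply: lt_le_trans H; rewrite !mulr_gt0//; lra.
have {}m0 : 0 < m * er ^+ 2 by rewrite -(pmulr_lgt0 _ u0).
have -> : 3 + e = 3 * k by rewrite /k; field.
have B0 : 0 < 2 * (3 * k) ^+ 2 * lam + 9 * m * er ^+ 2.
  have h : 0 < k ^+ 2 * lam by rewrite mulr_gt0 ?exprn_gt0.
  by nra.
have -> : 6 * (1 + e) * (3 * k) * - lam / (2 * (3 * k) ^+ 2 * - lam - 9 * m * er ^+ 2)
   = 6 * (1 + e) * (3 * k) * lam / (2 * (3 * k) ^+ 2 * lam + 9 * m * er ^+ 2).
  by field; apply/andP; split; apply/eqP => E; move: B0; lra.
rewrite ler_pdivrMr//.
have -> : 6 * (1 + e) * (3 * k) * lam = (1 + e) * (18 * k * lam) by ring.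
have -> : u * (1 + e) * (2 * (3 * k) ^+ 2 * lam + 9 * m * er ^+ 2) =
  (1 + e) * (18 * lam * k * (u * k) + 9 * (m * er ^+ 2 * u)) by ring.
by rewrite ler_pM2l; [lra|nra].
Qed.

Lemma decision_deviates (s l p : nat) delta ea er x mu :
  let lam := - log_level delta s in
  0 < lam -> 0 < ea -> 6 * ea / (3 - 2 * ea) < er < 1 -> ea < 3 / 8 ->
  0 <= x <= 1 -> 0 <= mu <= 1 ->
  (l = s -> 2 * (1 / er + 1 / 3) * (1 / ea - 1 / er - 1 / 3) * lam <= p%:R) ->
  decision delta ea er s l p x ->
  ~ (`|x - mu| < ea \/ `|x - mu| < er * mu) ->
  x != mu /\ 2 * lam * massart_var x mu <= p%:R * (x - mu) ^+ 2.
Proof.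
move=> lam lam0 ea0 /andP[ear er1] ea38 /andP[x0 x1] /andP[mu0 mu1] Hm Hdec.
move=> /not_orP[/negP + /negP]; rewrite -!leNgt => Hea Her.
have LE : log_level delta s = - lam by rewrite /lam opprK.
have er0 : 0 < er by apply: le_lt_trans ear; apply: divr_ge0; lra.
have er01 : 0 < er < 1 by rewrite er0.
have p0 : 0 <= p%:R :> R by [].
have hw : ea * (1 / er + 1 / 3) <= 1 / 2.
  move: ear; rewrite ltr_pdivrMr; last by lra.
  move=> h; rewrite -(ler_pM2r er0).
  have -> : ea * (1 / er + 1 / 3) * er = ea + ea * er / 3 by field; lra.
  lra.
have xmu : x != mu.
  by apply: contraTneq Hea => ->; rewrite subrr normr0 -ltNge.
split=> //; rewrite leNgt; apply/negP => H.
have [ltxmu|ltmux|] := ltgtP x mu; last by apply/eqP.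
(* Below the mean, missing both tolerances gives [x + ea <= mu] and [x / (1 - er) <= mu]. *)
- rewrite ltr0_norm in Hea Her; last by lra.
  have G1 : p%:R * ea ^+ 2 < 2 * lam * ((x + 2 / 3 * ea) * (1 - (x + 2 / 3 * ea))).
    have /(_ (x + ea)) := massart_closer p0 x0 _ _ mu1 H.
    rewrite /massart_var (_ : 2 / 3 * (x + ea) + x / 3 = x + 2 / 3 * ea); last by field.
    rewrite (_ : x - (x + ea) = - ea) ?sqrrN; last by ring.
    by apply; lra.
  have G2 : 0 < x -> p%:R * (x - x / (1 + - er)) ^+ 2 <
        2 * lam * massart_var x (x / (1 + - er)).
    have er1' : 0 < 1 + - er by lra.
    move=> x0'; apply: massart_closer H => //.
      by rewrite ltr_pdivlMr//; nra.
    by rewrite ler_pdivrMr//; lra.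
  have [g0 g1] := absolute_gap lam0 G1.
  have ner : - er != 0 by lra.
  have ner1 : -1 < - er by lra.
  have g2 := relative_gap lam0 p0 ner1 ner x0 G2.
  move: Hdec; rewrite /decision => /orP[/eqP/Hm {}Hm|].
    (* At the last stage the relative gap gives [x < ea / er - ea], so [w] is small enough for
       [last_stage_size] to contradict [G1]. *)
    have := @last_stage_size _ _ _ _ (x + 2 / 3 * ea) lam0 ea0 er0 hw Hm.
    have eN : `|- er| = er by rewrite normrN gtr0_norm.
    have := relative_gap_last lam0 ea0 er01 eN hw Hm g2.
    have -> : ea / er * (1 + - er) = ea * (1 / er) - ea by field; lra.
    by move=> ? h; move: G1; apply/negP; rewrite -leNgt; apply: h; lra.
  apply/negP; rewrite negbK; apply/orP; left.
  rewrite /in_gap_upper /radicand LE g0 /=; apply/andP; split; first by lra.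
  by move: g2; rewrite sqrrN.
- rewrite gtr0_norm in Hea Her; last by lra.
  have G1 : p%:R * ea ^+ 2 < 2 * lam * ((x - 2 / 3 * ea) * (1 - (x - 2 / 3 * ea))).
    have /(_ (x - ea)) := massart_closerC p0 x1 _ _ mu0 H.
    rewrite /massart_var (_ : 2 / 3 * (x - ea) + x / 3 = x - 2 / 3 * ea); last by field.
    rewrite (_ : x - (x - ea) = ea); last by ring.
    by apply; lra.
  have G2 : 0 < x -> p%:R * (x - x / (1 + er)) ^+ 2 <
        2 * lam * massart_var x (x / (1 + er)).
    have er1' : 0 < 1 + er by lra.
    move=> x0'; apply: massart_closerC H => //.
      by rewrite ltr_pdivrMr//; nra.
    by rewrite ler_pdivlMr//; lra.
  have [g0 g1] := absolute_gap lam0 G1.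
  have ner : er != 0 by lra.
  have ner1 : -1 < er by lra.
  have g2 := relative_gap lam0 p0 ner1 ner x0 G2.
  move: Hdec; rewrite /decision => /orP[/eqP/Hm {}Hm|].
    (* Now [x < ea / er + ea], that is [w < ea (1 / er + 1 / 3)]: exactly the range of
       [last_stage_size]. *)
    have := @last_stage_size _ _ _ _ (x - 2 / 3 * ea) lam0 ea0 er0 hw Hm.
    have eN : `|er| = er by rewrite gtr0_norm.
    have := relative_gap_last lam0 ea0 er01 eN hw Hm g2.
    have -> : ea / er * (1 + er) = ea * (1 / er) + ea by field; lra.
    by move=> ? h; move: G1; apply/negP; rewrite -leNgt; apply: h; lra.
  apply/negP; rewrite negbK; apply/orP; right.
  rewrite /in_gap_lower /radicand LE g0 /=; apply/andP; split; first by lra.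
  exact: g2.
Qed.
End gap.

(** * Massart's bound on the relative entropy *)

Section massart.
Set Implicit Arguments.
Unset Strict Implicit.
Context {R : realType}.
Implicit Types u v w z : R.

(** The convex function [1 / (u (1 - u))] lies above its tangent at [w]: the gap factors explicitly,
    with [(u - w)^2] as a factor. *)
Lemma inv_var_tangent u w : 0 < u < 1 -> 0 < w < 1 ->
  (w * (1 - w))^-1 + (2 * w - 1) / (w * (1 - w)) ^+ 2 * (u - w) <=
  (u * (1 - u))^-1.
Proof.
move=> /andP[u0 u1] /andP[w0 w1].
have U : 0 < u * (1 - u) by apply: mulr_gt0; lra.
have W : 0 < w * (1 - w) by apply: mulr_gt0; lra.
rewrite -subr_ge0.
have -> : (u * (1 - u))^-1 -
    ((w * (1 - w))^-1 + (2 * w - 1) / (w * (1 - w)) ^+ 2 * (u - w)) =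
  (u - w) ^+ 2 * ((1 - u) * (1 - w) ^+ 2 + u * w ^+ 2) /
    (u * (1 - u) * (w * (1 - w)) ^+ 2).
  by field; lra.
apply: divr_ge0; last by apply: mulr_ge0; [exact: ltW|exact: sqr_ge0].
apply: mulr_ge0; first exact: sqr_ge0.
by apply: addr_ge0; apply: mulr_ge0; rewrite ?sqr_ge0//; lra.
Qed.

(* The derivative in [u] of the relative entropy of [z] with respect to [u] is
   [- (z - u) h(u)] with [h u = 1 / (u (1 - u))] convex; replacing [h] by its
   tangent at the centroid [(2 v + z) / 3] of the weight [z - u] on [[v, z]]
   leaves only the constant term after integration. *)
Lemma massart_entropy v z : 0 < v -> v < z -> z < 1 ->
  z * ln v + (1 - z) * ln (1 - v) <=
  z * ln z + (1 - z) * ln (1 - z) - (z - v) ^+ 2 / (2 * massart_var z v).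
Proof.
move=> v0 vz z1; set w := 2 / 3 * v + z / 3.
have w0 : 0 < w < 1 by apply/andP; split; rewrite /w; lra.
pose a := (w * (1 - w))^-1; pose b := (2 * w - 1) / (w * (1 - w)) ^+ 2.
(* The polynomial part has derivative [- (z - u) (a + b (u - w))], so [G] has derivative [(z - u)]
   times the gap between [1 / (u (1 - u))] and its tangent, which is nonnegative on [[v, z]]. *)
pose G u := z * ln u + (1 - z) * ln (1 - u) +
  (a / 2 * (z - u) ^+ 2 + b * ((z - w) / 2 * (z - u) ^+ 2 - (z - u) ^+ 3 / 3)).
pose dG u := (z - u) * ((u * (1 - u))^-1 - (a + b * (u - w))).
have dGP u : 0 < u -> u < 1 -> is_derive u 1 G (dG u).
  move=> u0 u1.
  have lnu := is_derive1_ln u0.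
  have u1' : 0 < 1 - u by lra.
  have lnu' := is_derive1_ln u1'.
  have d1u : is_derive u 1 (fun u : R => 1 - u) (-1).
    by apply: is_derive_eq; rewrite add0r mul1r.
  have lnu'' : is_derive u 1 (fun u : R => ln (1 - u)) (- (1 - u)^-1).
    have := @is_derive1_comp _ (@ln R) (fun u : R => 1 - u) u _ _ lnu' d1u.
    by rewrite mulrN1.
  rewrite /G /dG; apply: is_derive_eq.
  rewrite /GRing.scale/=; clearbody a b; field.
  by apply/andP; split; lra.
have inoo u : v < u < z -> 0 < u < 1 by move=> /andP[? ?]; lra.
have Gvz : G v <= G z.
  have [| |c] := @MVT_segment R G dG v z (ltW vz).
  - by move=> u; rewrite in_itv/= => /inoo/andP[? ?]; exact: dGP.
  - apply: derivable_within_continuous => u; rewrite in_itv/= => /andP[? ?].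
    by apply: ex_derive; apply: dGP; lra.
  rewrite in_itv/= => /andP[vc cz] E; rewrite -subr_ge0 E.
  rewrite mulr_ge0 ?subr_ge0 ?(ltW vz)// /dG mulr_ge0 ?subr_ge0//.
  by apply: inv_var_tangent => //; apply/andP; split; lra.
have Gz : G z = z * ln z + (1 - z) * ln (1 - z).
  by rewrite /G subrr; field.
have Gv : G v = z * ln v + (1 - z) * ln (1 - v) + (z - v) ^+ 2 / (2 * massart_var z v).
  have -> : (z - v) ^+ 2 / (2 * massart_var z v) = a / 2 * (z - v) ^+ 2.
    by rewrite /a /massart_var -/w; field; lra.
  rewrite /G; congr (_ + _).
  (* The slope term cancels because [z - w = 2/3 (z - v)]. *)
  have -> : (z - w) / 2 * (z - v) ^+ 2 - (z - v) ^+ 3 / 3 = 0 by rewrite /w; field.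
  by rewrite mulr0 addr0.
by rewrite lerBrDr -Gv -Gz.
Qed.

(** The optimal Chernoff parameter for a Bernoulli variable of mean [v] is [t = ln q], nonnegative
    since [v < z]. There [1 - v + v q = (1 - v) / (1 - z)], and the left side is the exponential of
    minus the relative entropy. *)
Lemma massart_exponent v z : 0 < v -> v < z -> z < 1 -> exists2 t : R, 0 <= t &
  expR (- t * z) * (1 - v + v * expR t) <=
  expR (- ((z - v) ^+ 2 / (2 * massart_var z v))).
Proof.
move=> v0 vz z1; pose q := z * (1 - v) / (v * (1 - z)).
have z0 : 0 < z by lra.
have v1' : 0 < 1 - v by lra.
have z1' : 0 < 1 - z by lra.
have q0 : 0 < q by rewrite divr_gt0// mulr_gt0.
exists (ln q).
  by apply: ln_ge0; rewrite ler_pdivlMr ?mulr_gt0//; nra.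
rewrite lnK ?posrE//.
have -> : 1 - v + v * q = expR (ln (1 - v) - ln (1 - z)).
  by rewrite -ln_div ?posrE// lnK ?posrE ?divr_gt0// /q; field; lra.
rewrite -expRD ler_expR /q ln_div ?posrE ?mulr_gt0// !lnM ?posrE//.
have := massart_entropy v0 vz z1.
set M := _ / (2 * _); nra.
Qed.

End massart.

(** * The Chernoff bound *)

Section chernoff.
Set Implicit Arguments.
Unset Strict Implicit.
Context {R : realType} d (T : measurableType d) (P : probability T R).

Lemma measure_le_cover (I : choiceType) (r : seq I) (A : set T) (F : I -> set T) :
  uniq r -> (forall i, measurable (F i)) -> measurable A ->
  A `<=` \bigcup_(i in [set` r]) F i -> (P A <= \sum_(i <- r) P (F i))%E.
Proof. by move=> ur mF mA AF; rewrite fsbig_seq//; exact: content_sub_fsum. Qed.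

(* Independence is only given for events: rounding each sample up to the grid
   [k / N] turns the exponential moment of the sum into a finite sum of
   probabilities of cells. The rounding error vanishes in [chernoff_bound]. *)
Definition grid_cell (N k : nat) : set R :=
  `](k%:R - 1) / N%:R, k%:R / N%:R]%classic.

Lemma measurable_grid_cell N k : measurable (grid_cell N k).
Proof. exact: measurable_itv. Qed.

(** The index is the ceiling of [N x]. Cell 0, which is []-1/N, 0]], catches [x = 0], hence [N + 1]
    cells. *)
Lemma grid_cellP N x : (0 < N)%N -> 0 <= x <= 1 ->
  exists k : 'I_N.+1, grid_cell N k x.
Proof.
move=> N0 /andP[x0 x1]; have N0' : 0 < N%:R :> R by rewrite ltr0n.
have Nx0 : 0 <= N%:R * x by rewrite mulr_ge0.
have /andP[cl cr] := real_ceil_itv (num_real (N%:R * x)).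
have c0 : 0 <= Num.ceil (N%:R * x).
  by rewrite real_ceil_ge0 ?num_real// (lt_le_trans _ Nx0).
have cN : Num.ceil (N%:R * x) <= N%:Z.
  by rewrite real_ceil_le_int ?num_real// -[leRHS]mulr1 ler_wpM2l.
have kN : (`|Num.ceil (N%:R * x)|%N < N.+1)%N.
  by rewrite ltnS -lez_nat gez0_abs.
exists (Ordinal kN); rewrite /grid_cell/= in_itv/= natr_absz ger0_norm//.
rewrite ltr_pdivrMr// ler_pdivlMr// ![x * _]mulrC cr andbT.
by rewrite intrB in cl.
Qed.

Lemma grid_cell_inj N k j x : (0 < N)%N ->
  grid_cell N k x -> grid_cell N j x -> k = j.
Proof.
move=> N0; have N0' : 0 < N%:R :> R by rewrite ltr0n.
rewrite /grid_cell/= !in_itv/= !ltr_pdivrMr// !ler_pdivlMr//.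
move=> /andP[a b] /andP[c e]; apply/eqP; rewrite eqn_leq.
apply/andP; split; rewrite -ltnS -(ltr_nat R) -natr1; lra.
Qed.

Lemma expR_chord (t y : R) : 0 <= y <= 1 -> expR (t * y) <= 1 + (expR t - 1) * y.
Proof.
move=> y01.
have [y0 y1] := andP y01.
have := @convex_expR R (Itv01 y0 y1) t 0.
rewrite !convRE/= /unstable.onem mulr0 addr0 expR0 mulr1 [y * t]mulrC.
by move=> /le_trans; apply; lra.
Qed.

Variable (Z : {RV P >-> R}) (mu : R).
Hypothesis Z01 : forall w, 0 <= Z w <= 1.
Hypothesis Zmu : ('E_P[Z] = mu%:E)%E.

Definition cell_prob (N k : nat) : R := fine (P (Z @^-1` grid_cell N k)).

Lemma measurable_cell N k : measurable (Z @^-1` grid_cell N k).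
Proof. by apply: measurable_funPTI; exact: measurable_grid_cell. Qed.

Lemma cell_probE N k : (cell_prob N k)%:E = P (Z @^-1` grid_cell N k).
Proof. by rewrite fineK// fin_num_measure//; exact: measurable_cell. Qed.

(** Pointwise, only the cell containing [Z w] contributes. The chord of the exponential makes its
    term affine in the rounded value, which exceeds [Z w] by at most [1 / N]; taking expectations
    concludes. *)
Lemma grid_mgf_le N t : (0 < N)%N -> 0 <= t ->
  \sum_(k < N.+1) expR (t * (k%:R / N%:R)) * cell_prob N k <=
  1 + (expR t - 1) * (mu + N%:R^-1).
Proof.
move=> N0 t0; have N0' : 0 < N%:R :> R by rewrite ltr0n.
have a0 : 0 <= expR t - 1 by rewrite subr_ge0 -expR0 ler_expR.
pose f (k : 'I_N.+1) w := expR (t * (k%:R / N%:R)) * \1_(Z @^-1` grid_cell N k) w.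
have f0 k w : 0 <= f k w by rewrite mulr_ge0 ?expR_ge0.
have mf k : measurable_fun setT (f k).
  by apply: measurable_funM => //; apply: measurable_indic; exact: measurable_cell.
have mEf k : measurable_fun setT (fun w => (f k w)%:E) by exact/measurable_EFinP.
rewrite -lee_fin -sumEFin.
have -> : (\sum_(k < N.+1) (expR (t * (k%:R / N%:R)) * cell_prob N k)%:E =
    \int[P]_w \sum_(k < N.+1) (f k w)%:E)%E.
  rewrite ge0_integral_sum//; last by move=> k w _; rewrite lee_fin.
  apply: eq_bigr => k _.
  rewrite (integralZl_indic _ (fun=> Z @^-1` grid_cell N k))//; last 2 first.
  - by move=> /lt_geF; rewrite expR_ge0.
  - exact: measurable_cell.
  by rewrite integral_indic ?setIT ?EFinM ?cell_probE//; exact: measurable_cell.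
have g0 : 0 <= 1 + (expR t - 1) / N%:R :> R.
  by rewrite addr_ge0// divr_ge0// ltW.
have EZ : (\int[P]_w ((1 + (expR t - 1) / N%:R)%:E + (expR t - 1)%:E * (Z w)%:E) =
    (1 + (expR t - 1) * (mu + N%:R^-1))%:E)%E.
  rewrite ge0_integralD//=; last 2 first.
  - by move=> w _; rewrite -EFinM lee_fin mulr_ge0//; have /andP[] := Z01 w.
  - apply: measurable_funeM; exact/measurable_EFinP.
  rewrite (integral_cst P measurableT) [X in (_ * X)%E]probability_setT mule1.
  rewrite ge0_integralZl//; last 2 first.
  - exact/measurable_EFinP.
  - by move=> w _; rewrite lee_fin; have /andP[] := Z01 w.
  rewrite -expectation_def Zmu -EFinM -EFinD; congr EFin; ring.
rewrite -EZ; apply: ge0_le_integral => //.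
- by move=> w _; apply: sume_ge0 => k _; rewrite lee_fin.
- by apply: emeasurable_sum.
- apply: emeasurable_funD => //; apply: measurable_funeM; exact/measurable_EFinP.
move=> w _; rewrite sumEFin -EFinM -EFinD lee_fin.
have [k kw] := grid_cellP N0 (Z01 w).
rewrite (bigD1 k)//= big1 ?addr0 => [|j jk]; last first.
  rewrite /f indicE memNset ?mulr0//= => jw.
  by move/eqP: jk; apply; apply/val_inj/(grid_cell_inj N0 jw kw).
rewrite /f indicE mem_set// mulr1.
have k01 : 0 <= (k%:R / N%:R : R) <= 1.
  by rewrite divr_ge0//= ler_pdivrMr// mul1r ler_nat -ltnS ltn_ord.
apply: (le_trans (@expR_chord t _ k01)).
move: kw; rewrite /grid_cell/= in_itv/= mulrBl div1r => /andP[kl _].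
rewrite -addrA lerD2l -mulrDr ler_wpM2l//; lra.
Qed.

Variable (X : nat -> {RV P >-> R}).
Hypothesis iidX : iid_samples Z X.

(** Independence is stated for sets indexed by [nat], so [insub] extends the choice of cells by
    [setT] outside ['I_n]. *)
Lemma probability_cells N n (k : {ffun 'I_n -> 'I_N.+1}) :
  P (\bigcap_(i in [set` iota 0 n])
      (X i @^-1` if insub i is Some j then grid_cell N (k j) else setT)) =
  (\prod_(i < n) cell_prob N (k i))%:E.
Proof.
rewrite (iidX.1 (iota 0 n) (fun i => if insub i is Some j then grid_cell N (k j)
  else setT)) ?iota_uniq//; last first.
  by move=> i _; case: insub => // j; exact: measurable_grid_cell.
rewrite -[in iota 0 n](subn0 n) -/(index_iota 0 n) big_mkord -prodEFin.
apply: eq_bigr => i _; rewrite valK cell_probE.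
exact: (iidX.2 i _ (measurable_grid_cell N (k i))).
Qed.

(** The event is covered by the products of cells whose rounded sum reaches [n z]. Markov's
    inequality then becomes a weighting of these products by exponentials. *)
Lemma chernoff_grid N n t z (E : set T) : (0 < N)%N -> 0 <= t -> measurable E ->
  (forall w, E w -> n%:R * z <= \sum_(i < n) X i w /\ forall i, 0 <= X i w <= 1) ->
  (P E <= ((expR (- t * z) * (1 + (expR t - 1) * (mu + N%:R^-1))) ^+ n)%:E)%E.
Proof.
move=> N0 t0 mE EP.
pose C (k : {ffun 'I_n -> 'I_N.+1}) := \bigcap_(i in [set` iota 0 n])
  (X i @^-1` if insub i is Some j then grid_cell N (k j) else setT).
pose r := [seq k : {ffun 'I_n -> 'I_N.+1} <- enum {: {ffun 'I_n -> 'I_N.+1}} |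
  n%:R * z <= \sum_i (k i)%:R / N%:R].
have mC k : measurable (C k).
  apply: bigcap_measurableType => i _; apply: measurable_funPTI.
  by case: insub => // j; exact: measurable_grid_cell.
have EC : E `<=` \bigcup_(k in [set` r]) C k.
  move=> w /EP[zw X01].
  pose k : {ffun 'I_n -> 'I_N.+1} :=
    [ffun i : 'I_n => sval (cid (grid_cellP N0 (X01 i)))].
  have kP i : grid_cell N (k i) (X i w).
    by rewrite ffunE; exact: (svalP (cid (grid_cellP N0 (X01 i)))).
  exists k => /=; last first.
    by move=> i _ /=; case: insubP => //= j _ <-; exact: kP.
  rewrite mem_filter mem_enum andbT; apply: (le_trans zw).
  apply: ler_sum => i _; have := kP i.
  by rewrite /grid_cell/= in_itv/= => /andP[].
have ur : uniq r by rewrite filter_uniq ?enum_uniq.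
apply: (le_trans (measure_le_cover ur mC mE EC)).
under eq_bigr do rewrite probability_cells.
rewrite sumEFin lee_fin /r big_filter big_mkcond/= big_enum/=.
(* The weight is at least 1 on the selected tuples, and the other tuples add nonnegative terms. The
   unrestricted sum factors into an [n]-th power. *)
apply: (@le_trans _ _ (\sum_(k : {ffun 'I_n -> 'I_N.+1})
   \prod_(i < n) (expR (t * ((k i)%:R / N%:R - z)) * cell_prob N (k i)))).
  apply: ler_sum => k _; case: ifPn => [zk|_]; last first.
    by apply: prodr_ge0 => i _; rewrite mulr_ge0 ?expR_ge0 ?fine_ge0.
  rewrite big_split/= ler_peMl//.
    by apply: prodr_ge0 => i _; rewrite fine_ge0.
  rewrite -expR_sum -[leLHS]expR0 ler_expR -mulr_sumr mulr_ge0// sumrB subr_ge0.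
  by rewrite sumr_const card_ord -[leLHS]mulr_natl.
rewrite -(bigA_distr_bigA (fun (i : 'I_n) (j : 'I_N.+1) =>
  expR (t * (j%:R / N%:R - z)) * cell_prob N j)).
rewrite prodr_const card_ord lerXn2r// ?nnegrE.
- by apply: sumr_ge0 => j _; rewrite mulr_ge0 ?expR_ge0 ?fine_ge0.
- rewrite mulr_ge0 ?expR_ge0//; apply: le_trans (grid_mgf_le N0 t0).
  by apply: sumr_ge0 => j _; rewrite mulr_ge0 ?expR_ge0 ?fine_ge0.
rewrite -(ler_pM2l (expR_gt0 (t * z))) !mulrA -expRD mulNr subrr expR0 mul1r.
apply: le_trans (grid_mgf_le N0 t0); rewrite mulr_sumr; apply: ler_sum => j _.
by rewrite mulrA -expRD mulrBr addrC subrK.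
Qed.

(** Moving both [mu] and [z] inwards by [h] gives the strict inequalities of [massart_exponent] even
    at [mu = 0] or [z = 1], and leaves room for a rounding error [1 / N <= h]. Then [h] tends to
    0. *)
Lemma chernoff_bound n z (E : set T) :
  mu < z -> z <= 1 -> 0 <= mu -> measurable E ->
  (forall w, E w -> n%:R * z <= \sum_(i < n) X i w /\ forall i, 0 <= X i w <= 1) ->
  (P E <= (expR (- (n%:R * ((z - mu) ^+ 2 / (2 * massart_var z mu)))))%:E)%E.
Proof.
move=> muz z1 mu0 mE EP.
pose f (h : R) := expR (- (n%:R * ((z - h - (mu + h)) ^+ 2 /
  (2 * massart_var (z - h) (mu + h))))).
have Pf h : 0 < h -> h < (z - mu) / 2 -> (P E <= (f h)%:E)%E.
  move=> h0 hz.
  have [t t0 Ht] := @massart_exponent R (mu + h) (z - h)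
    (ltac:(lra)) (ltac:(lra)) (ltac:(lra)).
  have [N N0 Nh] : exists2 N, (0 < N)%N & N%:R^-1 <= h.
    exists (Num.truncn h^-1).+1 => //.
    rewrite invf_ple ?posrE//; exact/ltW/truncnS_gt.
  have EP' w : E w -> n%:R * (z - h) <= \sum_(i < n) X i w /\
      forall i, 0 <= X i w <= 1.
    move=> /EP[zX ?]; split=> //; apply: le_trans zX.
    by rewrite ler_wpM2l//; lra.
  apply: (le_trans (chernoff_grid N0 t0 mE EP')).
  rewrite lee_fin /f -mulrN expRM_natl.
  have et1 : 0 <= expR t - 1 by rewrite subr_ge0 -expR0 ler_expR.
  have N0' : 0 <= N%:R^-1 :> R by rewrite invr_ge0.
  rewrite lerXn2r ?nnegrE ?expR_ge0//.
    by rewrite mulr_ge0 ?expR_ge0// addr_ge0// mulr_ge0// addr_ge0.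
  apply: le_trans Ht; rewrite ler_wpM2l ?expR_ge0//.
  have : (expR t - 1) * (mu + N%:R^-1) <= (expR t - 1) * (mu + h).
    by rewrite ler_wpM2l// lerD2l.
  lra.
have cz : z - h @[h --> 0^'+] --> z.
  rewrite -[X in _ --> X]subr0; apply: cvg_at_right_filter.
  by apply: cvgB; [exact: cvg_cst|exact: cvg_id].
have cmu : mu + h @[h --> 0^'+] --> mu.
  rewrite -[X in _ --> X]addr0; apply: cvg_at_right_filter.
  by apply: cvgD; [exact: cvg_cst|exact: cvg_id].
have cw : 2 / 3 * (mu + h) + (z - h) / 3 @[h --> 0^'+] --> 2 / 3 * mu + z / 3.
  by apply: cvgD; [exact: cvgMr|exact: cvgMl].
have cV : massart_var (z - h) (mu + h) @[h --> 0^'+] --> massart_var z mu.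
  by apply: cvgM => //; apply: cvgB => //; exact: cvg_cst.
have V0 : 0 < massart_var z mu.
  by rewrite /massart_var; apply: mulr_gt0; lra.
have cg : - (n%:R * ((z - h - (mu + h)) ^+ 2 / (2 * massart_var (z - h) (mu + h))))
    @[h --> 0^'+] --> - (n%:R * ((z - mu) ^+ 2 / (2 * massart_var z mu))).
  apply: cvgN; apply: cvgMr; apply: cvgM.
    by apply: cvgM; exact: cvgB.
  by apply: cvgV; [lra|exact: cvgMr].
have cf : f h @[h --> 0^'+] -->
    expR (- (n%:R * ((z - mu) ^+ 2 / (2 * massart_var z mu)))).
  by have := cvg_comp _ _ cg (@continuous_expR R _).
have PE : P E \is a fin_num by exact: fin_num_measure.
rewrite -(fineK PE) lee_fin; apply: (cvgr_to_ge cf).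
near=> h; rewrite -lee_fin fineK//; apply: Pf => //.
near: h; apply: nbhs_right_lt; lra.
Unshelve. all: by end_near. Qed.

End chernoff.

(** * Tail events *)

Section tail.
Set Implicit Arguments.
Unset Strict Implicit.
Context {R : realType}.

(** This turns Massart's implicit condition on [x] into a fixed threshold. With [y = z - mu] the
    equation is [a y^2 = b y + e], and [y] is its larger root. *)
Lemma massart_root (c mu : R) : 0 < c -> 0 <= mu -> mu < 1 ->
  exists z, [/\ mu < z, (z - mu) ^+ 2 = c * massart_var z mu &
    forall x, mu < x -> c * massart_var x mu <= (x - mu) ^+ 2 -> z <= x].
Proof.
move=> c0 mu0 mu1; pose a := 1 + c / 9; pose b := c * (1 - 2 * mu) / 3.
pose e := c * (mu * (1 - mu)).
have VE y : c * massart_var (mu + y) mu = b * y + e - (a - 1) * y ^+ 2.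
  by rewrite /massart_var /a /b /e; field.
have a0 : 0 < a by rewrite /a; lra.
have e0 : 0 <= e by rewrite /e; apply: mulr_ge0; [exact: ltW|apply: mulr_ge0; lra].
have D0 : 0 <= b ^+ 2 + 4 * a * e.
  by rewrite addr_ge0 ?sqr_ge0// mulr_ge0// mulr_ge0// ltW.
pose y := (b + Num.sqrt (b ^+ 2 + 4 * a * e)) / (2 * a).
have yE : a * y ^+ 2 = b * y + e.
  have := sqr_sqrtr D0; rewrite /y; set q := Num.sqrt _ => qE.
  have -> : a * ((b + q) / (2 * a)) ^+ 2 = (b ^+ 2 + 2 * b * q + q ^+ 2) / (4 * a).
    by field; lra.
  by rewrite qE; field; lra.
have y0 : 0 < y.
  rewrite divr_gt0//; last by lra.
  (* If [b <= 0] then [mu >= 1/2], so [e > 0] and the square root exceeds [|b|]. *)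
  have [b0|b0] := ltP 0 b; first by rewrite ltr_pwDl// sqrtr_ge0.
  have mu2 : 1 / 2 <= mu.
    rewrite leNgt; apply/negP => h; move: b0; apply/negP; rewrite -ltNge.
    by rewrite /b divr_gt0// mulr_gt0//; lra.
  have e0' : 0 < e by rewrite /e !mulr_gt0//; lra.
  have ae0 : 0 < 4 * a * e by apply: mulr_gt0 => //; apply: mulr_gt0.
  rewrite -ltrBlDl sub0r -(ler0_norm b0) -sqrtr_sqr ltr_sqrt ?ltrDl//.
  by rewrite ltr_wpDl ?sqr_ge0.
clearbody y; clearbody a b e.
exists (mu + y); split; first by lra.
  by rewrite VE; lra.
move=> x mux; rewrite -[x](subrKC mu) VE => H.
rewrite lerD2l leNgt; apply/negP => xy.
set u := x - mu in H xy; have u0 : 0 < u by rewrite /u; lra.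
clearbody u.
have H' : b * u + e <= a * u ^+ 2 by lra.
(* Eliminating [b] from the next two relations gives [(e + a u y) (y - u) <= 0], which is impossible
   for [0 < u < y]. *)
have : y * (b * u + e) <= y * (a * u ^+ 2) by rewrite ler_pM2l.
have : u * (a * y ^+ 2) = u * (b * y + e) by rewrite yE.
have yu : 0 < y - u by rewrite subr_gt0.
have : 0 < a * (u * y) * (y - u) by do ?apply: mulr_gt0.
have : 0 <= e * (y - u) by rewrite mulr_ge0// subr_ge0 ltW.
lra.
Qed.

Context d (T : measurableType d) (P : probability T R).

Lemma sample_mean_le (X : nat -> T -> R) n z w : (0 < n)%N ->
  (z <= sample_mean X n w) = (n%:R * z <= \sum_(i < n) X i w).
Proof. by move=> n0; rewrite /sample_mean mulrC ler_pdivlMr ?ltr0n// mulrC. Qed.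

Lemma sample_mean01 (X : nat -> T -> R) n w : (0 < n)%N ->
  (forall i, 0 <= X i w <= 1) -> 0 <= sample_mean X n w <= 1.
Proof.
move=> n0 X01; have n0' : 0 < n%:R :> R by rewrite ltr0n.
rewrite mulr_ge0 ?invr_ge0//=; last first.
  by apply: sumr_ge0 => i _; have /andP[] := X01 i.
rewrite /sample_mean mulrC ler_pdivrMr// mul1r.
rewrite (@le_trans _ _ (\sum_(i < n) 1))//; last by rewrite sumr_const card_ord.
by apply: ler_sum => i _; have /andP[] := X01 i.
Qed.

Lemma measurable_sample_mean (X : nat -> {RV P >-> R}) n :
  measurable_fun setT (sample_mean X n).
Proof.
by apply: measurable_funM => //; apply: measurable_sum => i.
Qed.

(** Samples share only the law of [Z], so they lie in [[0, 1]] almost surely rather than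
    everywhere. *)
Definition unit_samples (X : nat -> T -> R) : set T :=
  \bigcap_i (X i @^-1` `[0, 1]).

Lemma unit_samplesP (X : nat -> T -> R) w :
  unit_samples X w <-> forall i, 0 <= X i w <= 1.
Proof.
split=> [h i|h i _]; last by rewrite /= in_itv/=; exact: h.
by have := h i I; rewrite /= in_itv.
Qed.

Lemma measurable_unit_samples (X : nat -> {RV P >-> R}) :
  measurable (unit_samples X).
Proof. by apply: bigcap_measurableType => i _; apply: measurable_funPTI. Qed.

Lemma expectation01 (Z : {RV P >-> R}) mu :
  (forall w, 0 <= Z w <= 1) -> ('E_P[Z] = mu%:E)%E -> 0 <= mu.
Proof.
move=> Z01 Zmu; rewrite -lee_fin -Zmu; apply: expectation_ge0 => w.
by have /andP[] := Z01 w.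
Qed.

(** The event is a half-line for the sample mean, starting at the root [z] where Massart's exponent
    times [n] is exactly [lam]. It is empty when [mu] or [z] leaves no room below 1. *)
Lemma upper_tail (Z : {RV P >-> R}) (X : nat -> {RV P >-> R}) mu lam n :
  (forall w, 0 <= Z w <= 1) -> ('E_P[Z] = mu%:E)%E -> iid_samples Z X ->
  0 < lam -> (0 < n)%N ->
  exists E : set T, [/\ measurable E, (P E <= (expR (- lam))%:E)%E &
    forall w, unit_samples X w -> mu < sample_mean X n w ->
      2 * lam * massart_var (sample_mean X n w) mu <=
        n%:R * (sample_mean X n w - mu) ^+ 2 -> E w].
Proof.
move=> Z01 Zmu iidX lam0 n0; have mu0 := expectation01 Z01 Zmu.
have n0' : 0 < n%:R :> R by rewrite ltr0n.
have [mu1|mu1] := leP 1 mu.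
  exists set0; rewrite measure0; split=> //.
  move=> w /unit_samplesP X01; have /andP[_ +] := @sample_mean01 X n w n0 X01; lra.
have c0 : 0 < 2 * lam / n%:R by rewrite divr_gt0// mulr_gt0.
have [z [muz zE zmin]] := massart_root c0 mu0 mu1.
have zx w : mu < sample_mean X n w ->
    2 * lam * massart_var (sample_mean X n w) mu <=
        n%:R * (sample_mean X n w - mu) ^+ 2 -> z <= sample_mean X n w.
  move=> mux H; apply: zmin => //.
  by rewrite mulrAC ler_pdivrMr// [leRHS]mulrC.
have [z1|z1] := ltP 1 z.
  exists set0; rewrite measure0; split=> //.
  move=> w /unit_samplesP X01 mux H; have /andP[_ +] := @sample_mean01 X n w n0 X01.
  by have := zx _ mux H; lra.
have mE : measurable (unit_samples X `&` sample_mean X n @^-1` `[z, +oo[).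
  apply: measurableI; first exact: measurable_unit_samples.
  by rewrite -[X in measurable X]setTI; apply: measurable_sample_mean.
exists (unit_samples X `&` sample_mean X n @^-1` `[z, +oo[); split=> //; last first.
  by move=> w Xw mux H; split=> //=; rewrite in_itv/= andbT; exact: zx.
have -> : lam = n%:R * ((z - mu) ^+ 2 / (2 * massart_var z mu)).
  have V0 : 0 < massart_var z mu by rewrite /massart_var; apply: mulr_gt0; lra.
  by rewrite zE; field; rewrite !lt0r_neq0.
apply: (chernoff_bound Z01 Zmu iidX) => // w [/unit_samplesP X01 /=].
by rewrite in_itv/= andbT sample_mean_le.
Qed.

(** * Reflection of the samples and the lower tail *)

Lemma measurable_onem (A : set R) : measurable A ->
  measurable ((fun x : R => 1 - x) @^-1` A).
Proof.
move=> mA; rewrite -[X in measurable X]setTI.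
have : measurable_fun setT (fun x : R => 1 - x) by exact: measurable_funB.
exact.
Qed.

Definition onem_rv (Y : {RV P >-> R}) : {RV P >-> R} :=
  [the {mfun T >-> R} of cst 1 \- Y].

Lemma iid_samples_onem (Z : {RV P >-> R}) (X : nat -> {RV P >-> R}) :
  iid_samples Z X -> iid_samples (onem_rv Z) (fun i => onem_rv (X i)).
Proof.
move=> [indep law]; split=> [J A uJ mA|i A mA].
  apply: (indep J (fun i => (fun x : R => 1 - x) @^-1` A i) uJ) => i iJ.
  by apply: measurable_onem; exact: mA.
exact: (law i _ (measurable_onem mA)).
Qed.

Lemma expectation_onem (Z : {RV P >-> R}) mu : (forall w, 0 <= Z w <= 1) ->
  ('E_P[Z] = mu%:E)%E -> ('E_P[onem_rv Z] = (1 - mu)%:E)%E.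
Proof.
move=> Z01; rewrite !expectation_def => Zmu.
have : (\int[P]_w ((onem_rv Z w)%:E + (Z w)%:E) = 1)%E.
  under eq_integral do rewrite /= -EFinD subrK.
  by rewrite (integral_cst P measurableT) [X in (_ * X)%E]probability_setT mule1.
rewrite ge0_integralD//; last 4 first.
- by move=> w _; rewrite lee_fin /= subr_ge0; have /andP[] := Z01 w.
- exact/measurable_EFinP.
- by move=> w _; rewrite lee_fin; have /andP[] := Z01 w.
- exact/measurable_EFinP.
rewrite Zmu EFinB => /eqP; rewrite eq_sym => /eqP ->.
by rewrite addeK.
Qed.

Lemma sample_mean_onem (X : nat -> T -> R) n w : (0 < n)%N ->
  sample_mean (fun i w => 1 - X i w) n w = 1 - sample_mean X n w.
Proof.
move=> n0; rewrite /sample_mean sumrB sumr_const card_ord mulrBr.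
by rewrite mulVf// pnatr_eq0 -lt0n.
Qed.

(** This is the upper tail of the samples [1 - X i], of mean [1 - mu]; [massart_varC] preserves the
    exponent. *)
Lemma lower_tail (Z : {RV P >-> R}) (X : nat -> {RV P >-> R}) mu lam n :
  (forall w, 0 <= Z w <= 1) -> ('E_P[Z] = mu%:E)%E -> iid_samples Z X ->
  0 < lam -> (0 < n)%N ->
  exists E : set T, [/\ measurable E, (P E <= (expR (- lam))%:E)%E &
    forall w, unit_samples X w -> sample_mean X n w < mu ->
      2 * lam * massart_var (sample_mean X n w) mu <=
        n%:R * (sample_mean X n w - mu) ^+ 2 -> E w].
Proof.
move=> Z01 Zmu iidX lam0 n0.
have Z01' w : 0 <= onem_rv Z w <= 1.
  by have /andP[? ?] := Z01 w; rewrite /= subr_ge0 lerBlDr lerDl; apply/andP.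
have [E [mE PE EP]] :=
  upper_tail Z01' (expectation_onem Z01 Zmu) (iid_samples_onem iidX) lam0 n0.
exists E; split=> // w /unit_samplesP X01 xmu H; apply: EP.
- apply/unit_samplesP => i; have /andP[? ?] := X01 i.
  by rewrite /= subr_ge0 lerBlDr lerDl; apply/andP.
- by rewrite (@sample_mean_onem X)// ltrD2l ltrN2.
rewrite (@sample_mean_onem X)// massart_varC.
by rewrite (_ : _ - _ - _ = - (sample_mean X n w - mu)) ?sqrrN//; ring.
Qed.

Lemma unit_samples_ae (Z : {RV P >-> R}) (X : nat -> {RV P >-> R}) :
  (forall w, 0 <= Z w <= 1) -> iid_samples Z X -> P (~` unit_samples X) = 0%E.
Proof.
move=> Z01 iidX; rewrite /unit_samples setC_bigcap.
have m01 : measurable (~` `[0, 1] : set R) by apply: measurableC.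
have : P.-negligible (\bigcup_i (~` (X i @^-1` `[0, 1]))).
  apply: negligible_bigcup => i; exists (X i @^-1` ~` `[0, 1]); split=> //.
    exact: measurable_funPTI.
  rewrite [LHS](iidX.2 i _ m01) /distribution /pushforward.
  rewrite (_ : _ @^-1` _ = set0) ?measure0// -subset0 => w /=.
  by rewrite in_itv/= Z01.
by apply: measure_negligible; apply: bigcup_measurable => i _;
  apply: measurableC; apply: measurable_funPTI.
Qed.

End tail.

(** * Coverage probability *)

Section stopping.
Set Implicit Arguments.
Unset Strict Implicit.

Lemma measurable_find d (T : measurableType d) (D : nat -> T -> bool)
    (r : seq nat) (k : nat) :
  (forall l, measurable [set w | D l w]) ->
  measurable [set w | find (D^~ w) r = k].
Proof.
move=> mD; elim: r k => [|l r IH] [|k] /=.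
- by rewrite (_ : [set _ | _] = setT)//; apply/seteqP; split.
- by rewrite (_ : [set _ | _] = set0)//; apply/seteqP; split.
- rewrite (_ : [set _ | _] = [set w | D l w])//.
  by apply/seteqP; split=> w /=; case: (D l w).
rewrite (_ : [set _ | _] =
    ~` [set w | D l w] `&` [set w | find (D^~ w) r = k]).
  exact: measurableI (measurableC (mD l)) (IH k).
apply/seteqP; split=> w /=; case: (D l w) => //=; first by move=> [<-].
  by move=> [/(_ isT)].
by move=> [_ ->].
Qed.

Context {R : realType}.
Implicit Types delta ea er : R.

Lemma measurable_decision delta ea er (s l m : nat) :
  measurable [set x : R | decision delta ea er s l m x].
Proof.
have mitv (b : bool) (a c : R) : measurable [set x : R | [&& b, a < x & x < c]].
  rewrite (_ : [set _ | _] = if b then `]a, c[%classic else set0).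
    by case: ifP.
  by case: b; apply/seteqP; split=> x //=; rewrite in_itv.
have [ls|ls] := eqVneq l s.
  rewrite (_ : [set _ | _] = setT)//; apply/seteqP; split=> // x _.
  by rewrite /decision/= ls eqxx.
rewrite (_ : [set _ | _] = ~` ([set x | in_gap_upper delta ea er s m x] `|`
                               [set x | in_gap_lower delta ea er s m x])).
  by apply: measurableC; apply: measurableU; exact: mitv.
apply/seteqP; split=> x /=; rewrite /decision (negbTE ls) /=.
  by move=> /negP h g; apply: h; apply/orP.
by move=> h; apply/negP => /orP.
Qed.

Lemma measurable_norm_lt (mu a : R) : measurable [set x : R | `|x - mu| < a].
Proof.
rewrite (_ : [set _ | _] = `]mu - a, mu + a[%classic)//.
by apply/seteqP; split=> x /=; rewrite in_itv/= ltr_distl.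
Qed.

Lemma log_levelE delta (s : nat) : 0 < delta -> (0 < s)%N ->
  - log_level delta s = ln (2 * s%:R / delta).
Proof.
move=> d0 s0; have s0' : 0 < s%:R :> R by rewrite ltr0n.
by rewrite /log_level -lnV ?posrE ?divr_gt0 ?mulr_gt0// invf_div.
Qed.

End stopping.

Theorem theorem10 (R : realType) (d : measure_display) (T : measurableType d)
    (P : probability T R) (Z : {RV P >-> R}) (X : nat -> {RV P >-> R}) (mu : R)
    (delta eps_a eps_r : R) (s : nat) (n : nat -> nat)
    (Z01 : forall w, 0 <= Z w <= 1)
    (Zmu : ('E_P[Z] = mu%:E)%E)
    (iidX : iid_samples Z X)
    (hdelta : 0 < delta < 1)
    (heps_a : 0 < eps_a < 3 / 8)
    (heps_r : 6 * eps_a / (3 - 2 * eps_a) < eps_r < 1)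
    (hs : (0 < s)%N)
    (n_gt0 : forall l, (1 <= l <= s)%N -> (0 < n l)%N)
    (n_incr : forall l, (1 <= l < s)%N -> (n l < n l.+1)%N)
    (hns : 2 * (1 / eps_r + 1 / 3) * (1 / eps_a - 1 / eps_r - 1 / 3)
             * ln (2 * s%:R / delta) <= (n s)%:R) :
  let mu_hat := stopped_mean delta eps_a eps_r s n X in
  ((1 - delta)%:E <=
    P [set w | (`|mu_hat w - mu| < eps_a)%R \/
                (`|mu_hat w - mu| < eps_r * mu)%R])%E.
Proof.
cbv zeta; set mu_hat := stopped_mean _ _ _ _ _ _; set acc := [set w | _].
have [d0 d1] := andP hdelta; have [ea0 ea1] := andP heps_a.
have s0 : 0 < s%:R :> R by rewrite ltr0n.
pose D l w := decision delta eps_a eps_r s l (n l) (sample_mean X (n l) w).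
pose accu x := `|x - mu| < eps_a \/ `|x - mu| < eps_r * mu.
pose lam := - log_level delta s.
have elam : expR (- lam) = delta / (2 * s%:R).
  by rewrite opprK lnK// posrE divr_gt0// mulr_gt0.
(* The budget [delta / s] of a stage is shared equally by its two tails. *)
have dsE : delta / s%:R = expR (- lam) + expR (- lam).
  by rewrite elam; field; rewrite gt_eqF.
have lam0 : 0 < lam.
  rewrite -[_ < _]ltrN2 oppr0 -ltr_expR elam expR0 ltr_pdivrMr ?mulr_gt0// mul1r.
  have : 1 <= s%:R :> R by rewrite ler1n.
  by clear Zmu; lra.
have mu01 : 0 <= mu <= 1.
  have h := expectation01 _ (expectation_onem Z01 Zmu).
  rewrite (expectation01 Z01 Zmu) -subr_ge0; apply: h => w /=.
  by have := Z01 w; clear Zmu; lra.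
have mD l : measurable [set w | D l w].
  rewrite -[X in measurable X]setTI.
  have mdec := measurable_decision delta eps_a eps_r s l (n l).
  exact: (measurable_sample_mean X (n l) measurableT mdec).
have stageE l : exists E : set T, [/\ measurable E, (P E <= (delta / s%:R)%:E)%E &
    (1 <= l <= s)%N -> forall w, unit_samples X w -> D l w ->
      ~ accu (sample_mean X (n l) w) -> E w].
  (* Indices that are not stages receive the empty event, so that [choice] yields a family over all
     of [nat]. *)
  have [ls|ls] := boolP (1 <= l <= s)%N; last first.
    by exists set0; split=> //; rewrite measure0 lee_fin divr_ge0 ?ltW.
  have nl0 := n_gt0 l ls.
  have [U [mU PU UP]] := upper_tail Z01 Zmu iidX lam0 nl0.
  have [V [mV PV VP]] := lower_tail Z01 Zmu iidX lam0 nl0.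
  exists (U `|` V); split; first exact: measurableU.
    apply: (le_trans (measureU2 _ mU mV)).
    by rewrite dsE EFinD; exact: leeD.
  move=> _ w Xw Dw naccu.
  have x01 := @sample_mean01 R _ T X (n l) w nl0 (iffLR (unit_samplesP _ _) Xw).
  have hm : l = s -> 2 * (1 / eps_r + 1 / 3) * (1 / eps_a - 1 / eps_r - 1 / 3) *
      - log_level delta s <= (n l)%:R.
    by move=> ->; rewrite log_levelE.
  have [xmu H] := decision_deviates lam0 ea0 heps_r ea1 x01 mu01 hm Dw naccu.
  by case: (ltgtP (sample_mean X (n l) w) mu) xmu => // h _; [right|left]; auto.
have [E EP] := choice stageE.
(* The index 0, which is not a stage, carries the null set of bad samples. *)
pose F l := if l is 0%N then ~` unit_samples X else E l.
have mF l : measurable (F l).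
  case: l => [|l] /=; first by apply: measurableC; exact: measurable_unit_samples.
  by have [] := EP l.+1.
(* The sample size is random, so the event is split along the value of [find], one less than the
   stopping index. *)
have macc : measurable acc.
  rewrite (_ : acc = \bigcup_k ([set w | find (D^~ w) (iota 1 s) = k] `&`
       (sample_mean X (n k.+1)) @^-1` [set x | accu x])).
    apply: bigcup_measurable => k _; apply: measurableI.
      exact: measurable_find.
    rewrite -[X in measurable X]setTI; apply: measurable_sample_mean => //.
    by apply: measurableU; exact: measurable_norm_lt.
  apply/seteqP; split=> w /=.
    by exists (find (D^~ w) (iota 1 s)).
  by move=> [k _ [<-]].
have cover : ~` acc `<=` \bigcup_(l in [set` iota 0 s.+1]) F l.
  move=> w nacc; have [Xw|] := pselect (unit_samples X w); last by exists 0%N.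
  have Ds : D s w by rewrite /D /decision eqxx.
  have [ls Dl _] := @stopping_indexP s (D^~ w) hs Ds.
  pose l := stopping_index s (D^~ w); rewrite -/l in ls Dl.
  have [_ _ h] := EP l.
  exists l.
    suff : l \in iota 0 s.+1 by [].
    by rewrite mem_iota ltnS; have /andP[] := ls.
  exact: (h ls w Xw Dl nacc).
have PnA : (P (~` acc) <= delta%:E)%E.
  apply: (le_trans (measure_le_cover P (iota_uniq _ _) mF (measurableC macc) cover)).
  (* The null set at index 0 contributes nothing; the [s] stages remain. *)
  rewrite /= big_cons /= (unit_samples_ae Z01 iidX) add0e.
  apply: (@le_trans _ _ (\sum_(l <- iota 1 s) (delta / s%:R)%:E)%E).
    rewrite !big_seq; apply: lee_sum => l; rewrite mem_iota.
    by case: l => // l _; have [] := EP l.+1.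
  rewrite sumEFin lee_fin big_const_seq count_predT size_iota iter_addr_0.
  by rewrite -[leLHS]mulr_natr divfK// gt_eqF.
rewrite probability_setC// in PnA.
have Pf : P acc \is a fin_num by exact: fin_num_measure.
move: PnA; rewrite -(fineK Pf) -EFinB !lee_fin; clear Zmu; lra.
Qed.
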